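(* Suppose Assumptions 1, 2, 4 and 5 (stated in the context) hold, and for each $i\in\mathcal V$ take any finite (possibly empty) $\widetilde Y_i^0\subset Y_i$. Then the distributed lower bounding procedure is convergent, i.e. $\sum_{i=1}^m f_i(\widetilde x_i^{k+1})\to F^*$ as $k\to\infty$. Moreover, $\sum_{i=1}^m f_i(\widetilde x_i^{k+1})\le F^*$ for every $k\ge0$.
   Context: **Problem.** Let $\mathcal V=\{1,\dots,m\}$ be a set of agents. The distributed robust convex optimization problem (DRCO) is $$\min_{x\in\mathbb R^n} F(x)=\sum_{i=1}^m f_i(x)\quad\text{s.t. } g_i(x,y_i)\le 0\ \ \forall y_i\in Y_i,\ i=1,\dots,m,$$ where $Y_i\subseteq\mathbb R^{n_y}$ is non-empty and compact, $f_i:\mathbb R^n\to\mathbb R$ is convex, and $g_i:\mathbb R^n\times Y_i\to\mathbb R$ is convex in $x$ and continuous in $y_i$. Let $X_i=\{x: g_i(x,y_i)\le 0\ \forall y_i\in Y_i\}$ (convex and compact by standing assumption), $X=\bigcap_{i=1}^m X_i$, and let $F^*$ be the optimal value of (DRCO). **Communication.** At time slot $t$ agents communicate over a directed graph $\mathcal G(t)$ on vertex set $\mathcal V$. **Assumption 1.** $X\neq\emptyset$ and $F$ is strictly convex on $\mathbb R^n$; (DRCO) is solvable with a unique optimal solution $x^*$. **Assumption 2 (uniformly strong connectivity).** There is an integer $T>0$ such that for all $t\ge0$ the graph on $\mathcal V$ whose edge set is the union of the edge sets of $\mathcal G(t),\dots,\mathcal G(t+T-1)$ is strongly connected. **Assumption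 4.** For distributed convex optimization problems with finitely many inequality constraints under uniformly strongly connected networks, the decision variables of all agents reach an optimal consensus solution within finitely many time slots. In particular, in each iteration of the procedure below, all agents obtain one and the same optimal solution of the approximation problem. **Assumption 5.** For each $i$ and each iteration, at each query point $\hat x_i$ the problem $\max_{y_i\in Y_i}g_i(\hat x_i,y_i)$ is globally solved, either establishing that the maximum is $\le 0$ or furnishing $\hat y_i$ with $g_i(\hat x_i,\hat y_i)>0$. **Distributed lower bounding procedure.** For $k=0,1,2,\dots$: every agent obtains the optimal solution $x_i^{k+1}=x^{k+1}$ of $$(\mathrm{DLBD}^k)\quad \min_x F(x)\ \text{ s.t. } g_i(x,y_i)\le 0\ \forall y_i\in\widetilde Y_i^k,\ i=1,\dots,m,$$ and sets $\widetilde x_i^{k+1}=x_i^{k+1}$. If $\max_{y_i\in Y_i}g_i(x_i^{k+1},y_i)>0$, put $\widetilde Y_i^{k+1}=\widetilde Y_i^k\cup\{\hat y_i\}$ with $\hat y_i\in\arg\max_{y_i\in Y_i}g_i(x_i^{k+1},y_i)$; otherwise $\widetilde Y_i^{k+1}=\widetilde Y_i^k$. *)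

(* Defs.v *)
From mathcomp Require Import all_boot all_order all_algebra finmap.
From mathcomp Require Import all_classical all_reals all_analysis.

Set Implicit Arguments.
Unset Strict Implicit.
Unset Printing Implicit Defensive.

Import Order.TTheory GRing.Theory Num.Theory.
Import numFieldNormedType.Exports.
Local Open Scope classical_set_scope.
Local Open Scope ring_scope.

Definition argmin (R : realType) (T : Type) (A : set T) (h : T -> R) : set T :=
  [set x | A x /\ forall z, A z -> h x <= h z].

Definition argmax (R : realType) (T : Type) (A : set T) (h : T -> R) : set T :=
  [set x | A x /\ forall z, A z -> h z <= h x].

Definition convex_fun (R : realType) (n : nat) (h : 'rV[R]_n -> R) : Prop :=
  @convex_function R 'rV[R]_n setT h.

Definition strictly_convex_fun (R : realType) (n : nat)
    (h : 'rV[R]_n -> R) : Prop :=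
  forall (x y : 'rV[R]_n) (t : R), x != y -> 0 < t -> t < 1 ->
    h (t *: x + (1 - t) *: y) < t * h x + (1 - t) * h y.

Definition total_cost (R : realType) (m n : nat) (f : 'I_m -> 'rV[R]_n -> R)
    (x : 'rV[R]_n) : R :=
  \sum_(i < m) f i x.

(* The constraint functions are total in y; only their values, and their
   continuity within the uncertainty set, matter. *)
Definition robust_set (R : realType) (n p : nat)
    (gi : 'rV[R]_n -> 'rV[R]_p -> R) (Yi : set 'rV[R]_p) : set 'rV[R]_n :=
  [set x | forall y, Yi y -> gi x y <= 0].

Definition robust_feasible (R : realType) (m n p : nat)
    (g : 'I_m -> 'rV[R]_n -> 'rV[R]_p -> R) (Y : 'I_m -> set 'rV[R]_p) :
    set 'rV[R]_n :=
  \bigcap_(i in [set: 'I_m]) robust_set (g i) (Y i).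

Definition optimal_value (R : realType) (m n p : nat)
    (f : 'I_m -> 'rV[R]_n -> R) (g : 'I_m -> 'rV[R]_n -> 'rV[R]_p -> R)
    (Y : 'I_m -> set 'rV[R]_p) : R :=
  inf (total_cost f @` robust_feasible g Y).

(* G t u v : at time slot t there is an edge from u to v. *)
Definition network (m : nat) := nat -> rel 'I_m.

Definition strongly_connected (m : nat) (e : rel 'I_m) : Prop :=
  forall u v, connect e u v.

Definition union_graph (m : nat) (G : network m) (t T : nat) : rel 'I_m :=
  fun u v => [exists d : 'I_T, G (t + d)%N u v].

Definition uniformly_strongly_connected (m : nat) (G : network m) : Prop :=
  exists2 T : nat, (0 < T)%N &
    forall t : nat, strongly_connected (union_graph G t T).

(* Agent i privately holds the cost [costs P i] and the finitely many
   constraints h x <= 0, for h in [constraints P i]. *)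
Record fin_problem (R : realType) (m n : nat) := FinProblem {
  costs : 'I_m -> 'rV[R]_n -> R ;
  constraints : 'I_m -> seq ('rV[R]_n -> R) }.

Definition fin_convex (R : realType) (m n : nat) (P : fin_problem R m n) :
    Prop :=
  forall i, convex_fun (costs P i) /\
    (forall j, (j < size (constraints P i))%N ->
      convex_fun (nth (cst 0) (constraints P i) j)).

Definition fin_feasible (R : realType) (m n : nat) (P : fin_problem R m n) :
    set 'rV[R]_n :=
  [set x | forall i j, (j < size (constraints P i))%N ->
    nth (cst 0) (constraints P i) j x <= 0].

Definition fin_optimal (R : realType) (m n : nat) (P : fin_problem R m n) :
    set 'rV[R]_n :=
  argmin (fin_feasible P) (total_cost (costs P)).

(* [z t i] is the decision variable of agent i, t slots after the start. *)
Definition trajectory (R : realType) (m n : nat) := nat -> 'I_m -> 'rV[R]_n.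

(* A distributed algorithm for finitely constrained problems, described by its
   possible executions: [alg P G z] means that z may result from running it on
   P over the network G. It is a relation because the execution may also depend
   on the initial states of the agents. *)
Definition dist_algorithm (R : realType) (m n : nat) :=
  fin_problem R m n -> network m -> trajectory R m n -> Prop.

Definition reaches_optimal_consensus (R : realType) (m n : nat)
    (P : fin_problem R m n) (z : trajectory R m n) : Prop :=
  exists (N : nat) (x : 'rV[R]_n), fin_optimal P x /\
    forall t i, (N <= t)%N -> z t i = x.

(* Solvability is required of P: without it no algorithm has this property,
   since a convex problem, such as minimizing exp over the line, may have no
   optimal solution at all. *)
Definition finite_time_consensus (R : realType) (m n : nat)
    (alg : dist_algorithm R m n) : Prop :=
  forall (P : fin_problem R m n) (G : network m) (z : trajectory R m n),
    fin_convex P -> (exists x, fin_optimal P x) ->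
    uniformly_strongly_connected G -> alg P G z ->
    reaches_optimal_consensus P z.

Definition lower_problem (R : realType) (m n p : nat)
    (f : 'I_m -> 'rV[R]_n -> R) (g : 'I_m -> 'rV[R]_n -> 'rV[R]_p -> R)
    (Yt : 'I_m -> {fset 'rV[R]_p}) : fin_problem R m n :=
  FinProblem f (fun i => [seq (fun x => g i x y) | y <- enum_fset (Yt i)]).

(* The maximum, which is attained in the intended use: A non-empty and compact,
   h continuous on A. *)
Definition max_on (R : realType) (T : Type) (A : set T) (h : T -> R) : R :=
  sup (h @` A).

(* Answer of a global solver of max_A h: either it establishes that the maximum
   is nonpositive ([None]), or it furnishes a point of A where h is positive. *)
Definition solver_answer_correct (R : realType) (T : Type) (A : set T)
    (h : T -> R) (ans : option T) : Prop :=
  match ans with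
  | None => max_on A h <= 0
  | Some y => A y /\ 0 < h y
  end.

(* Iteration k occupies the time slots s k, ..., s k.+1 - 1. During it the
   agents run alg on the current approximation, with decision variables z k;
   [x k.+1 i] is the value at which the decision variable of agent i has
   settled when the iteration ends, and [ans k i] is the answer that agent i
   gets for max_(y in Y i) g i (x k.+1 i) y. [x 0] and [xt 0] are not used. *)
Record lower_bounding_procedure (R : realType) (m n p : nat)
    (f : 'I_m -> 'rV[R]_n -> R) (g : 'I_m -> 'rV[R]_n -> 'rV[R]_p -> R)
    (Y : 'I_m -> set 'rV[R]_p) (G : network m) (alg : dist_algorithm R m n)
    (s : nat -> nat) (z : nat -> trajectory R m n)
    (x xt : nat -> 'I_m -> 'rV[R]_n) (ans : nat -> 'I_m -> option 'rV[R]_p)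
    (Yt : nat -> 'I_m -> {fset 'rV[R]_p}) : Prop := {
  lbp_slots : forall k, (s k <= s k.+1)%N ;
  lbp_solve : forall k,
    alg (lower_problem f g (Yt k)) (fun t => G (s k + t)%N) (z k) ;
  lbp_settled : forall k i t, (s k.+1 <= s k + t)%N -> z k t i = x k.+1 i ;
  lbp_xt : forall k i, xt k.+1 i = x k.+1 i ;
  lbp_violated : forall k i, 0 < max_on (Y i) (g i (x k.+1 i)) ->
    exists y, [/\ ans k i = Some y,
                  argmax (Y i) (g i (x k.+1 i)) y &
                  Yt k.+1 i = (Yt k i `|` [fset y])%fset] ;
  lbp_satisfied : forall k i, max_on (Y i) (g i (x k.+1 i)) <= 0 ->
    Yt k.+1 i = Yt k i }.

(* Main.v *)
Require Import Defs.
From mathcomp Require Import all_boot all_order all_algebra finmap.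
From mathcomp Require Import all_classical all_reals all_analysis.
From mathcomp Require Import lra.

Set Implicit Arguments.
Unset Strict Implicit.
Unset Printing Implicit Defensive.

Import Order.TTheory GRing.Theory Num.Theory.
Import numFieldNormedType.Exports.
Local Open Scope classical_set_scope.
Local Open Scope ring_scope.

(** The optimal consensus values u_0, u_1, ... of the successive approximations
minimize F over a decreasing sequence of closed convex sets D_k that contain X,
so F (u_k) is nondecreasing and bounded by F*.  Only the convergence to F*
needs an argument, and it follows from two facts.

The sequence u_k has a cluster point.  All the u_k lie in D_0 and satisfy
F (u_k) <= F*, and a convex function with a unique minimizer over a closed
convex set has bounded level sets there ([convex_sublevel_bounded]): outside
the unit ball around the minimizer it grows at least linearly.  Strict
convexity of F gives the uniqueness.

Every cluster point a lies in X ([cuts_cluster_feasible]).  If the constraint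
of agent i were violated at a by some y in Y_i, it would be violated by a fixed
margin at all u_k near a, hence also by the worst case y_k that the procedure
adds to the cuts.  A later u_l near a satisfies the cut y_k, so that
g_i(., y_k) would drop by that margin between the nearby points u_k and u_l.
This is impossible if the functions g_i(., y), y in Y_i, are equicontinuous at
a.  They are, although g_i is not assumed to be jointly continuous: a pointwise
bounded family of convex functions on R^n is equicontinuous
([convex_family_equicontinuous]), and compactness of Y_i with continuity in y
gives pointwise boundedness.

Then F (a) >= F*, and since F, being convex, is continuous, F (u_k) exceeds
F* - e for some k and therefore for all later ones ([nested_argmin_cvg]). *)

(** * Convex functions on row vectors *)

Lemma convex_funP (R : realType) (n : nat) (h : 'rV[R]_n -> R) :
  convex_fun h <->
  forall (t : R) (u v : 'rV[R]_n), 0 <= t -> t <= 1 ->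
    h (t *: u + (1 - t) *: v) <= t * h u + (1 - t) * h v.
Proof.
split=> [ch t u v t0 t1|ch t u v _ _]; last exact: ch.
by have := ch (Itv01 t0 t1) u v; apply; rewrite inE.
Qed.

Lemma strictly_convex_funW (R : realType) (n : nat) (h : 'rV[R]_n -> R) :
  strictly_convex_fun h -> convex_fun h.
Proof.
move=> sh; apply/convex_funP => t u v t0 t1.
have [->|uv] := eqVneq u v.
  by rewrite -scalerDl addrC subrK scale1r -mulrDl addrC subrK mul1r.
have [->|tn0] := eqVneq t 0.
  by rewrite !(scale0r, subr0, scale1r, add0r, mul0r, mul1r).
have [->|tn1] := eqVneq t 1.
  by rewrite !(scale0r, subrr, scale1r, addr0, mul0r, mul1r).
by apply/ltW/sh => //; rewrite lt_neqAle ?t0 ?t1 ?tn1 1?eq_sym ?tn0.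
Qed.

Lemma convex_fun_ray (R : realType) (n : nat) (h : 'rV[R]_n -> R)
    (a v : 'rV[R]_n) (t : R) :
  convex_fun h -> 0 <= t -> t <= 1 ->
  h (a + t *: v) - h a <= t * (h (a + v) - h a).
Proof.
move=> /convex_funP ch t0 t1; have := ch t (a + v) a t0 t1.
rewrite scalerDr addrAC -scalerDl [t + _]addrC subrK scale1r => hle; lra.
Qed.

(** Jensen's inequality with equal weights: an average of N.+2 points is a
convex combination, with weight N.+1 / N.+2, of an average of N.+1 points and
the last one. *)
Lemma convex_fun_mean (R : realType) (n N : nat) (h : 'rV[R]_n -> R)
    (v : 'I_N.+1 -> 'rV[R]_n) :
  convex_fun h ->
  h (N.+1%:R^-1 *: \sum_(j < N.+1) v j) <= N.+1%:R^-1 * \sum_(j < N.+1) h (v j).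
Proof.
move=> /convex_funP ch; elim: N v => [|N IH] v.
  by rewrite !big_ord1 invr1 scale1r mul1r.
rewrite !(big_ord_recr N.+1) /=.
set S := \sum_(i < N.+1) v _; set T := \sum_(i < N.+1) h _.
have N1 : (N.+1%:R : R) != 0 by rewrite pnatr_eq0.
have N2 : (N.+2%:R : R) != 0 by rewrite pnatr_eq0.
pose t : R := N.+1%:R / N.+2%:R.
have t1 : 1 - t = N.+2%:R^-1.
  by rewrite /t -[X in X - _](divff N2) -mulrBl -natrB// subSnn mul1r.
have tS : N.+2%:R^-1 = t * N.+1%:R^-1 by rewrite /t mulrAC divff // mul1r.
have t_ge0 : 0 <= t by rewrite divr_ge0 ?ler0n.
have t_le1 : t <= 1 by rewrite -subr_ge0 t1 invr_ge0 ler0n.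
have := ch t (N.+1%:R^-1 *: S) (v ord_max) t_ge0 t_le1.
rewrite t1 scalerA -tS -scalerDr => /le_trans; apply.
rewrite [in leRHS]mulrDr lerD2r tS -(mulrA t) ler_wpM2l //.
exact: IH.
Qed.

(** * Equicontinuity of pointwise bounded families of convex functions *)

Lemma row_entry_le_norm (R : realType) (n : nat) (w : 'rV[R]_n) (j : 'I_n) :
  `|w 0 j| <= `|w|.
Proof.
rewrite -[leRHS]/(mx_norm w) mx_normrE.
exact: (le_bigmax _ (fun ij => `|w ij.1 ij.2|) (0, j)).
Qed.

(** The constant C depends on the values of the family at the 2n points a + e_j
and a - e_j only.  With w = sum_j w_j e_j, the point a + w is the average of the
points a + n w_j e_j, each of which lies on a segment from a to one of those 2n
points; this bounds h (a + w) - h a from above.  The bound from below comes from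
the one for - w, as a is the midpoint of a + w and a - w. *)
Lemma convex_family_lipschitz_at (R : realType) (n : nat) (I : Type)
    (Y : set I) (h : I -> 'rV[R]_n -> R) (a : 'rV[R]_n) :
  (forall y, Y y -> convex_fun (h y)) ->
  (forall u, exists M, forall y, Y y -> `|h y u| <= M) ->
  exists C, forall w, n%:R * `|w| <= 1 ->
    forall y, Y y -> `|h y (a + w) - h y a| <= C * `|w|.
Proof.
move=> ch /choice[B hB].
(* The average over the n coordinates only makes sense if n > 0. *)
case: n => [|n] in h a ch B hB *.
  by exists 0 => w _ y _; rewrite [a + w]thinmx0 [a]thinmx0 subrr normr0 mul0r.
pose e j : 'rV[R]_n.+1 := delta_mx 0 j.
pose C := \sum_j (B (a + e j) + B (a - e j) + B a).
exists C.
have upper w : n.+1%:R * `|w| <= 1 ->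
    forall y, Y y -> h y (a + w) - h y a <= C * `|w|.
  move=> w1 y Yy.
  have n0 : (0 : R) < n.+1%:R by rewrite ltr0n.
  have -> : a + w = n.+1%:R^-1 *: \sum_j (a + (n.+1%:R * w 0 j) *: e j).
    rewrite big_split /= sumr_const card_ord -[a *+ _]scaler_nat scalerDr.
    rewrite scalerA mulVf ?gt_eqF // scale1r; congr (_ + _).
    rewrite {1}[w]row_sum_delta scaler_sumr; apply: eq_bigr => j _.
    by rewrite scalerA mulKf ?gt_eqF.
  rewrite lerBlDr; apply: le_trans (convex_fun_mean _ (ch y Yy)) _.
  rewrite mulrC ler_pdivrMr // mulrDl [h y a * _]mulr_natr.
  have -> : h y a *+ n.+1 = \sum_(j < n.+1) h y a.
    by rewrite sumr_const card_ord.
  rewrite !mulr_suml -big_split /=.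
  apply: ler_sum => j _; rewrite -lerBlDr.
  have Bw v : h y (a + v) - h y a <= B (a + v) + B a.
    have := hB (a + v) y Yy; have := hB a y Yy.
    by rewrite !ler_norml => /andP[? ?] /andP[? ?]; lra.
  have B0 v : 0 <= B v by apply: le_trans (hB v y Yy).
  have wj : `|w 0 j| <= `|w| by exact: row_entry_le_norm.
  have Nw : n.+1%:R * `|w 0 j| <= n.+1%:R * `|w| by rewrite ler_pM2l.
  have t0 : 0 <= n.+1%:R * `|w 0 j| by rewrite mulr_ge0.
  have {}w1 := le_trans Nw w1.
  set b := B _ + _ + _.
  have bound v : h y (a + v) - h y a <= b ->
      h y (a + n.+1%:R * `|w 0 j| *: v) - h y a <= b * `|w| * n.+1%:R.
    move=> hb; apply: le_trans (convex_fun_ray _ _ (ch y Yy) t0 w1) _.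
    apply: le_trans (ler_wpM2l t0 hb) _.
    rewrite mulrC -mulrA [_ * _%:R]mulrC ler_wpM2l // /b.
    by rewrite !addr_ge0.
  have := B0 (a + e j); have := B0 (a - e j) => B1 B2.
  (* The sign of w_j decides whether to move along e_j or along - e_j. *)
  have [w0|w0] := lerP 0 (w 0 j).
    have := bound (e j); rewrite ger0_norm //; apply.
    by apply: le_trans (Bw _) _; rewrite /b; lra.
  have := bound (- e j).
  rewrite ltr0_norm // mulrN scalerN scaleNr opprK; apply.
  by apply: le_trans (Bw _) _; rewrite /b; lra.
move=> w w1 y Yy; rewrite ler_norml upper // andbT.
have := upper (- w); rewrite normrN => /(_ w1 y Yy) lo.
have /convex_funP/(_ (1/2) (a + w) (a - w)) := ch y Yy.
have -> : 1 / 2 *: (a + w) + (1 - 1 / 2) *: (a - w) = a.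
  have -> : 1 - 1 / 2 = 1 / 2 :> R by lra.
  rewrite -scalerDr addrACA subrr addr0 -mulr2n -[a *+ 2]scaler_nat scalerA.
  by rewrite mul1r mulVf ?scale1r // pnatr_eq0.
move=> mid; have {}mid := mid ltac:(lra) ltac:(lra); lra.
Qed.

Lemma convex_family_equicontinuous (R : realType) (n : nat) (I : Type)
    (Y : set I) (h : I -> 'rV[R]_n -> R) (a : 'rV[R]_n) (e : R) :
  (forall y, Y y -> convex_fun (h y)) ->
  (forall u, exists M, forall y, Y y -> `|h y u| <= M) ->
  0 < e -> \forall u \near a, forall y, Y y -> `|h y u - h y a| < e.
Proof.
move=> ch hb e0; have [C hC] := convex_family_lipschitz_at a ch hb.
have d0 : 0 < Num.min (n.+1%:R^-1) (e / (`|C| + 1)).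
  by rewrite lt_min invr_gt0 ltr0n divr_gt0 // ltr_wpDl.
(* The first radius is that of the Lipschitz estimate; the second makes its
right-hand side smaller than e, whatever the sign of C. *)
near=> u.
have : `|u - a| < Num.min (n.+1%:R^-1) (e / (`|C| + 1)).
  by near: u; apply: (@cvgr_distC_lt _ _ _ _ _ id a) => //; exact: cvg_id.
rewrite lt_min => /andP[ua1 ua2] y Yy.
have := hC (u - a) _ y Yy; rewrite [a + _]addrC subrK.
move=> /(_ _)/le_lt_trans; apply.
  rewrite -[leRHS](@mulfV _ n.+1%:R) ?pnatr_eq0 //.
  by rewrite ler_pM ?ler_nat // ltW.
move: ua2; rewrite ltr_pdivlMr ?ltr_wpDl // mulrDr mulr1 => ua2.
have : C * `|u - a| <= `|u - a| * `|C| by rewrite mulrC ler_wpM2l // ler_norm.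
have := normr_ge0 (u - a); lra.
Unshelve. all: by end_near. Qed.

(** A single convex function is a pointwise bounded family. *)
Lemma convex_fun_continuous (R : realType) (n : nat) (h : 'rV[R]_n -> R) :
  convex_fun h -> continuous h.
Proof.
move=> ch a; rewrite /continuous_at.
apply: (cvgrPdistC_lt (FF := nbhs_filter a) _ _).2 => e e0.
have hb u : exists M, forall y : unit, setT y -> `|h u| <= M by exists `|h u|.
have := @convex_family_equicontinuous R n unit setT (fun=> h) a e
  (fun _ _ => ch) hb e0.
by apply: filterS => u /(_ tt Logic.I).
Qed.

(** * Minimizers and level sets *)

(** Through [convex_fun_continuous], this shows that spheres and balls around a
are closed. *)
Lemma convex_fun_dist (R : realType) (n : nat) (a : 'rV[R]_n) :
  convex_fun (fun u => `|u - a|).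
Proof.
apply/convex_funP => t u v t0 t1.
have -> : t *: u + (1 - t) *: v - a = t *: (u - a) + (1 - t) *: (v - a).
  by rewrite !scalerBr addrACA -opprD -scalerDl [t + _]addrC subrK scale1r.
apply: le_trans (ler_normD _ _) _.
by rewrite !normrZ !ger0_norm // subr_ge0.
Qed.

(** On the intersection K of D with the unit sphere around u0, which is compact,
h exceeds h u0 by some d > 0.  By convexity along the segment from u0, h exceeds
h u0 by at least d times the distance to u0 at the points of D outside the unit
ball. *)
Lemma convex_sublevel_bounded (R : realType) (n : nat) (D : set 'rV[R]_n)
    (h : 'rV[R]_n -> R) (u0 : 'rV[R]_n) (c : R) :
  closed D -> @convex_set R 'rV[R]_n D -> convex_fun h ->
  D u0 -> (forall u, D u -> u != u0 -> h u0 < h u) ->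
  exists M, forall u, D u -> h u <= c -> `|u| <= M.
Proof.
move=> clD cvD ch Du0 umin.
pose K := D `&` [set u | `|u - u0| = 1].
have [d d0 hd] : exists2 d, 0 < d & forall u, K u -> h u0 + d <= h u.
  have [K0|K0] := pselect (K !=set0); last first.
    by exists 1 => // u Ku; case: K0; exists u.
  have cK : compact K.
    apply: bounded_closed_compact.
      exists (`|u0| + 1); split; first exact: num_real.
      move=> M ltM u [_ /= u1]; rewrite -[u](subrK u0).
      by apply: le_trans (ler_normD _ _) _; rewrite u1 addrC ltW.
    apply: closedI => //.
    apply: (@preimage_closed _ _ (fun u : 'rV[R]_n => `|u - u0|) [set 1]).
      by move=> u _; exact: (convex_fun_continuous (convex_fun_dist u0)).
    exact: closed_eq.
  have [v /set_mem[Dv v1] vmin] := compact_EVT_min K0 cK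
    (continuous_subspaceT (convex_fun_continuous ch)).
  exists (h v - h u0) => [|u Ku].
    rewrite subr_gt0; apply: umin => //.
    by apply: contra_eq_neq v1 => ->; rewrite subrr normr0 eq_sym oner_neq0.
  by rewrite addrC subrK vmin // inE.
(* The bound is 1 inside the unit ball and (c - h u0) / d outside it. *)
exists (`|u0| + (1 + `|c - h u0| / d)) => u Du uc.
rewrite -[u](subrK u0) addrC; apply: le_trans (ler_normD _ _) _.
rewrite lerD2l; set w := u - u0.
have cd0 : 0 <= `|c - h u0| / d by rewrite divr_ge0 // ltW.
have [w1|w1] := lerP `|w| 1; first by rewrite ler_wpDr.
have w0 : 0 < `|w| by apply: lt_trans w1.
have t0 : 0 <= `|w|^-1 by rewrite invr_ge0.
have t1 : `|w|^-1 <= 1 by rewrite invf_le1 // ltW.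
have Kw : K (u0 + `|w|^-1 *: w).
  split; last first.
    by rewrite /= addrAC subrr add0r normrZ normfV normr_id mulVf ?gt_eqF.
  have -> : u0 + `|w|^-1 *: w = `|w|^-1 *: u + (1 - `|w|^-1) *: u0.
    by rewrite scalerBr addrCA scalerBl scale1r.
  by have := cvD u u0 (Itv01 t0 t1); rewrite !inE; exact.
have := convex_fun_ray u0 w ch t0 t1; rewrite [u0 + w]addrC subrK.
move=> ray; have {hd} := hd _ Kw => hd.
have {hd ray} : d <= `|w|^-1 * (h u - h u0) by lra.
rewrite mulrC ler_pdivlMr // mulrC -ler_pdivlMr // => /le_trans; apply.
apply: (@le_trans _ _ (`|c - h u0| / d)); last by rewrite ler_wpDl.
rewrite ler_pM2r ?invr_gt0 //; apply: le_trans (ler_norm _); lra.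
Qed.

(** Otherwise the midpoint of u0 and u would beat u0. *)
Lemma strictly_convex_argmin_lt (R : realType) (n : nat) (D : set 'rV[R]_n)
    (h : 'rV[R]_n -> R) (u0 u : 'rV[R]_n) :
  @convex_set R 'rV[R]_n D -> strictly_convex_fun h ->
  argmin D h u0 -> D u -> u != u0 -> h u0 < h u.
Proof.
move=> cvD sh [Du0 u0min] Du uu0.
have h0 : 0 <= 1 / 2 :> R by lra.
have h1 : 1 / 2 <= 1 :> R by lra.
have := cvD u u0 (Itv01 h0 h1); rewrite !inE => /(_ Du Du0) /u0min.
have := sh u u0 (1/2) uu0 ltac:(lra) ltac:(lra) => lt mid.
have {lt} := le_lt_trans mid lt; lra.
Qed.

Lemma argmin_inf (R : realType) (T : Type) (A : set T) (h : T -> R) (a : T) :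
  argmin A h a -> inf (h @` A) = h a.
Proof.
move=> [Aa amin]; apply/eqP; rewrite eq_le; apply/andP; split.
  by apply: ge_inf; [exists (h a) => _ [b Ab <-]; exact: amin|exists a].
by apply: lb_le_inf; [exists (h a), a|move=> _ [b Ab <-]; exact: amin].
Qed.

(** * Worst-case cuts *)

Lemma compact_within_bounded (R : realType) (T : topologicalType) (A : set T)
    (h : T -> R) :
  compact A -> {within A, continuous h} ->
  exists M, forall y, A y -> `|h y| <= M.
Proof.
move=> cA ch; have [M [_ hM]] := compact_bounded (continuous_compact ch cA).
by exists (M + 1) => y Ay; apply: hM (M + 1) _ _ _; [rewrite ltrDl|exists y].
Qed.

Lemma le_max_on (R : realType) (T : topologicalType) (A : set T) (h : T -> R)
    (y : T) :
  compact A -> {within A, continuous h} -> A y -> h y <= max_on A h.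
Proof.
move=> cA ch Ay; have [M hM] := compact_within_bounded cA ch.
apply: ub_le_sup; last by exists y.
by exists M => _ [b Ab <-]; apply: le_trans (ler_norm _) (hM b Ab).
Qed.

Lemma cluster_nat_ge (T : topologicalType) (u : nat -> T) (a : T) (U : set T)
    (N : nat) :
  cluster (u @ \oo) a -> nbhs a U -> exists2 k, (N <= k)%N & U (u k).
Proof.
move=> ca Ua.
have [_ [[k /= Nk <-] Uk]] := ca [set u k | k in [set k | (N <= k)%N]] U
  (@filterS _ _ _ [set k | (N <= k)%N] _ (fun k Nk => ex_intro2 _ _ k Nk erefl)
     (nbhs_infty_ge N)) Ua.
by exists k.
Qed.

(** With e a quarter of the violation of the constraint y at a, take u k and
then u l, with l > k, so close to a that all the functions g (., y) vary by less
than e.  The worst case yk at u k is violated there by more than 3 e, and the cut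
yk is satisfied at u l, whereas g (u k) yk and g (u l) yk differ by less than
2 e. *)
Lemma cuts_cluster_feasible (R : realType) (n p : nat)
    (g : 'rV[R]_n -> 'rV[R]_p -> R) (Y : set 'rV[R]_p)
    (u : nat -> 'rV[R]_n) (a : 'rV[R]_n) :
  compact Y -> (forall y, Y y -> convex_fun (g^~ y)) ->
  (forall v, {within Y, continuous (g v)}) ->
  (forall k, 0 < max_on Y (g (u k)) ->
     exists2 y, argmax Y (g (u k)) y &
       forall l, (k < l)%N -> g (u l) y <= 0) ->
  cluster (u @ \oo) a -> robust_set g Y a.
Proof.
move=> cY gconv gcont cuts ca y Yy; rewrite leNgt; apply/negP => gay.
have e0 : 0 < g a y / 4 by lra.
have near_a := @convex_family_equicontinuous R n _ Y (fun y v => g v y) a _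
  gconv (fun v => compact_within_bounded cY (gcont v)) e0.
have [k _ uk] := cluster_nat_ge 0 ca near_a.
have [l kl ul] := cluster_nat_ge k.+1 ca near_a.
have uky : 3 * (g a y / 4) < g (u k) y.
  by have := uk y Yy; rewrite ltr_norml => /andP[]; lra.
have [|yk [Yyk ykmax] ulyk] := cuts k.
  by apply: lt_le_trans (le_max_on cY (gcont _) Yy); lra.
have := ykmax y Yy; have := ulyk l kl.
have := uk yk Yyk; have := ul yk Yyk.
rewrite !ltr_norml => /andP[? ?] /andP[? ?]; lra.
Qed.

(** * Finitely constrained problems *)

Lemma fin_feasible_closed (R : realType) (m n : nat) (P : fin_problem R m n) :
  fin_convex P -> closed (fin_feasible P).
Proof.
move=> cP.
have -> : fin_feasible P = \bigcap_(i in [set: 'I_m])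
    \bigcap_(j in [set j | (j < size (constraints P i))%N])
      nth (cst 0) (constraints P i) j @^-1` [set r | r <= 0].
  by apply/seteqP; split=> u H i; [move=> _ j; exact: H|move=> j; exact: H].
apply: closed_bigI => i _; apply: closed_bigI => j /(cP i).2 cj.
apply: preimage_closed (@closed_le _ 0) => u _.
exact: convex_fun_continuous.
Qed.

Lemma fin_feasible_convex (R : realType) (m n : nat) (P : fin_problem R m n) :
  fin_convex P -> @convex_set R 'rV[R]_n (fin_feasible P).
Proof.
move=> cP u v t; rewrite !inE => Du Dv i j jlt.
have := (cP i).2 j jlt t u v; rewrite !inE.
move=> /(_ Logic.I Logic.I)/le_trans; apply.
have := Du i j jlt; have := Dv i j jlt; set c := nth _ _ _ => cv cu.
have t0 : 0 <= t%:num by [].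
have t1 : 0 <= 1 - t%:num by rewrite subr_ge0.
have := mulr_ge0_le0 t0 cu; have := mulr_ge0_le0 t1 cv.
move=> ? ?; change (t%:num * c u + (1 - t%:num) * c v <= 0); lra.
Qed.

Lemma fin_feasible_lower (R : realType) (m n p : nat)
    (f : 'I_m -> 'rV[R]_n -> R) (g : 'I_m -> 'rV[R]_n -> 'rV[R]_p -> R)
    (Z : 'I_m -> {fset 'rV[R]_p}) (u : 'rV[R]_n) :
  fin_feasible (lower_problem f g Z) u <->
  forall i y, y \in Z i -> g i u y <= 0.
Proof.
split=> [fu i y yZ|gu i j].
  have yi : (index y (enum_fset (Z i)) < size (enum_fset (Z i)))%N.
    by rewrite index_mem.
  have := fu i (index y (enum_fset (Z i))); rewrite /= size_map => /(_ yi).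
  by rewrite (nth_map y) // nth_index.
rewrite /= size_map => jlt.
case E: (enum_fset (Z i)) jlt => [//|y0 s] jlt; rewrite -E in jlt *.
by rewrite (nth_map y0) //; apply: gu; exact: mem_nth.
Qed.

Lemma lower_problem_convex (R : realType) (m n p : nat)
    (f : 'I_m -> 'rV[R]_n -> R) (g : 'I_m -> 'rV[R]_n -> 'rV[R]_p -> R)
    (Y : 'I_m -> set 'rV[R]_p) (Z : 'I_m -> {fset 'rV[R]_p}) :
  (forall i, convex_fun (f i)) ->
  (forall i y, Y i y -> convex_fun (g i ^~ y)) ->
  (forall i, [set` Z i] `<=` Y i) -> fin_convex (lower_problem f g Z).
Proof.
move=> fc gc ZY i; split; first exact: fc.
rewrite /= size_map => j jlt.
case E: (enum_fset (Z i)) jlt => [//|y0 s] jlt; rewrite -E in jlt *.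
by rewrite (nth_map y0) //; apply/gc/ZY; exact: mem_nth.
Qed.

(** Minimizing over sets that decrease towards A yields values that increase
towards the minimum over A, as soon as no cluster point of the minimizers falls
outside A.  Closedness and convexity of the first, largest set, together with
strict convexity of h, keep the minimizers in a bounded set, so that there is a
cluster point. *)
Lemma nested_argmin_cvg (R : realType) (n : nat) (D : nat -> set 'rV[R]_n)
    (A : set 'rV[R]_n) (h : 'rV[R]_n -> R) (u : nat -> 'rV[R]_n)
    (xs : 'rV[R]_n) :
  closed (D 0%N) -> @convex_set R 'rV[R]_n (D 0%N) -> strictly_convex_fun h ->
  (forall k l, (k <= l)%N -> D l `<=` D k) -> (forall k, A `<=` D k) ->
  (forall k, argmin (D k) h (u k)) -> cluster (u @ \oo) `<=` A ->
  argmin A h xs ->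
  (fun k => h (u k)) @ \oo --> h xs /\ forall k, h (u k) <= h xs.
Proof.
move=> clD cvD sh Dmono AD umin clA [Axs xsmin].
have u_le k : h (u k) <= h xs by apply: (umin k).2; exact: AD.
split=> //.
have u_mono k l : (k <= l)%N -> h (u k) <= h (u l).
  by move=> kl; apply: (umin k).2; apply: Dmono kl _ (umin l).1.
have ch := strictly_convex_funW sh.
have [M uM] := @convex_sublevel_bounded _ _ _ _ _ (h xs) clD cvD ch (umin 0%N).1
  (fun v => strictly_convex_argmin_lt cvD sh (umin 0%N)).
have cK : compact [set v : 'rV[R]_n | `|v - 0| <= M].
  apply: bounded_closed_compact.
    by exists M; split=> [|N MN v /=]; [exact: num_real|rewrite subr0; lra].
  apply: (@preimage_closed _ _ (fun v : 'rV[R]_n => `|v - 0|)) (@closed_le _ M).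
  by move=> v _; exact: (convex_fun_continuous (convex_fun_dist 0)).
have [a [_ ca]] :
    [set v : 'rV[R]_n | `|v - 0| <= M] `&` cluster (u @ \oo) !=set0.
  apply: cK; exists 0%N => // k _; rewrite /= subr0; apply: uM => //.
  exact: Dmono (leq0n k) _ (umin k).1.
have ha : h xs <= h a by apply/xsmin/clA.
apply/cvgrPdist_le => e e0.
have Ua : \forall v \near a, h a - e < h v.
  have := convex_fun_continuous ch (x := a).
  by move=> /cvgr_gt; apply; rewrite gtrDl oppr_lt0.
have [k _ uk] := cluster_nat_ge 0 ca Ua.
exists k => // l /= kl; have := u_mono k l kl; have := u_le l.
by rewrite ler_norml => ? ?; apply/andP; split; lra.
Qed.

(** * The lower bounding procedure *)

(** The consensus assumption speaks of late time slots only, but by the time the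
iteration ends the decision variables no longer change, so that the values
which the agents keep are the consensus values.  The network seen by iteration
k is the original one shifted by s k, and remains uniformly strongly
connected. *)
Lemma lower_bounding_consensus (R : realType) (m n p : nat)
    (f : 'I_m -> 'rV[R]_n -> R) (g : 'I_m -> 'rV[R]_n -> 'rV[R]_p -> R)
    (Y : 'I_m -> set 'rV[R]_p) (G : network m) (alg : dist_algorithm R m n)
    (s : nat -> nat) (z : nat -> trajectory R m n)
    (x xt : nat -> 'I_m -> 'rV[R]_n) (ans : nat -> 'I_m -> option 'rV[R]_p)
    (Yt : nat -> 'I_m -> {fset 'rV[R]_p}) (k : nat) :
  uniformly_strongly_connected G -> finite_time_consensus alg ->
  lower_bounding_procedure f g Y G alg s z x xt ans Yt ->
  fin_convex (lower_problem f g (Yt k)) ->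
  (exists v, fin_optimal (lower_problem f g (Yt k)) v) ->
  exists v, fin_optimal (lower_problem f g (Yt k)) v /\
    forall i, x k.+1 i = v.
Proof.
move=> [T T0 Gconn] consensus proc cP solv.
have Gk : uniformly_strongly_connected (fun t => G (s k + t)%N).
  exists T => // t a b; rewrite -(eq_connect (e := union_graph G (s k + t) T)).
    exact: Gconn.
  by move=> c d; apply: eq_existsb => j; rewrite addnA.
have [N [v [vopt zN]]] := consensus _ _ _ cP solv Gk (lbp_solve proc k).
exists v; split=> // i.
have late : (s k.+1 <= s k + maxn N (s k.+1))%N.
  by rewrite (leq_trans (leq_maxr N _)) ?leq_addl.
by rewrite -(lbp_settled proc i late) zN ?leq_maxl.
Qed.

Lemma lower_bounding_cuts_mono (R : realType) (m n p : nat)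
    (f : 'I_m -> 'rV[R]_n -> R) (g : 'I_m -> 'rV[R]_n -> 'rV[R]_p -> R)
    (Y : 'I_m -> set 'rV[R]_p) (G : network m) (alg : dist_algorithm R m n)
    (s : nat -> nat) (z : nat -> trajectory R m n)
    (x xt : nat -> 'I_m -> 'rV[R]_n) (ans : nat -> 'I_m -> option 'rV[R]_p)
    (Yt : nat -> 'I_m -> {fset 'rV[R]_p}) (k l : nat) (i : 'I_m) :
  lower_bounding_procedure f g Y G alg s z x xt ans Yt ->
  (k <= l)%N -> {subset Yt k i <= Yt l i}.
Proof.
move=> proc /subnK <-; elim: (l - k)%N => [//|d IH] y /IH {IH}; rewrite addSn.
have [le0|gt0] := lerP (max_on (Y i) (g i (x (d + k).+1 i))) 0.
  by rewrite (lbp_satisfied proc le0).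
have [w [_ _ ->]] := lbp_violated proc gt0.
by rewrite in_fsetU => ->.
Qed.

(** Every added cut is a worst case over Y i, hence belongs to it.  The convexity
of the approximations and the inclusion of X in their feasible sets depend on
this. *)
Lemma lower_bounding_cuts_sub (R : realType) (m n p : nat)
    (f : 'I_m -> 'rV[R]_n -> R) (g : 'I_m -> 'rV[R]_n -> 'rV[R]_p -> R)
    (Y : 'I_m -> set 'rV[R]_p) (G : network m) (alg : dist_algorithm R m n)
    (s : nat -> nat) (z : nat -> trajectory R m n)
    (x xt : nat -> 'I_m -> 'rV[R]_n) (ans : nat -> 'I_m -> option 'rV[R]_p)
    (Yt : nat -> 'I_m -> {fset 'rV[R]_p}) (k : nat) (i : 'I_m) :
  lower_bounding_procedure f g Y G alg s z x xt ans Yt ->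
  [set` Yt 0%N i] `<=` Y i -> [set` Yt k i] `<=` Y i.
Proof.
move=> proc Y0; elim: k => [//|k IH].
have [le0|gt0] := lerP (max_on (Y i) (g i (x k.+1 i))) 0.
  by rewrite (lbp_satisfied proc le0).
have [w [_ [Yw _] ->]] := lbp_violated proc gt0.
by move=> y /=; rewrite in_fsetU in_fset1 => /orP[/IH //|/eqP ->].
Qed.

Theorem proposition1 (R : realType) (m n p : nat)
    (f : 'I_m -> 'rV[R]_n -> R) (g : 'I_m -> 'rV[R]_n -> 'rV[R]_p -> R)
    (Y : 'I_m -> set 'rV[R]_p)
    (G : network m) (alg : dist_algorithm R m n)
    (s : nat -> nat) (z : nat -> trajectory R m n)
    (x xt : nat -> 'I_m -> 'rV[R]_n) (ans : nat -> 'I_m -> option 'rV[R]_p)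
    (Yt : nat -> 'I_m -> {fset 'rV[R]_p})
    (* standing assumptions on (DRCO) *)
    (Y_nonempty : forall i, Y i !=set0)
    (Y_compact : forall i, compact (Y i))
    (f_convex : forall i, convex_fun (f i))
    (g_convex : forall i y, Y i y -> convex_fun (fun u => g i u y))
    (g_cont : forall i u, {within Y i, continuous (g i u)})
    (X_convex : forall i,
      @convex_set R 'rV[R]_n (robust_set (g i) (Y i)))
    (X_compact : forall i, compact (robust_set (g i) (Y i)))
    (* Assumption 1 *)
    (X_nonempty : robust_feasible g Y !=set0)
    (F_strict : strictly_convex_fun (total_cost f))
    (F_optimal : exists! xs, argmin (robust_feasible g Y) (total_cost f) xs)
    (* Assumption 2 *)
    (G_connected : uniformly_strongly_connected G)
    (* Assumption 4 *)
    (alg_consensus : finite_time_consensus alg)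
    (lower_solvable : forall k,
      exists xs, fin_optimal (lower_problem f g (Yt k)) xs)
    (* Assumption 5 *)
    (ans_correct : forall k i,
      solver_answer_correct (Y i) (g i (x k.+1 i)) (ans k i))
    (* the procedure, from arbitrary finite subsets of the uncertainty sets *)
    (Y0_sub : forall i, [set` Yt 0%N i] `<=` Y i)
    (procedure : lower_bounding_procedure f g Y G alg s z x xt ans Yt) :
  ((fun k : nat => \sum_(i < m) f i (xt k.+1 i)) @ \oo
     --> optimal_value f g Y) /\
  (forall k : nat, \sum_(i < m) f i (xt k.+1 i) <= optimal_value f g Y).
Proof.
have cP k : fin_convex (lower_problem f g (Yt k)).
  apply: lower_problem_convex f_convex g_convex _ => i.
  exact: (lower_bounding_cuts_sub procedure (Y0_sub i)).
have /choice[u hu] k := lower_bounding_consensus G_connected alg_consensus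
  procedure (cP k) (lower_solvable k).
have uopt k := (hu k).1.
have xu k i : x k.+1 i = u k := (hu k).2 i.
have [xs [xs_opt _]] := F_optimal.
pose D k := fin_feasible (lower_problem f g (Yt k)).
have XD k : robust_feasible g Y `<=` D k.
  move=> v vX; apply/fin_feasible_lower => i y yZ; apply: (vX i Logic.I).
  exact: (lower_bounding_cuts_sub procedure (Y0_sub i)) yZ.
have Dmono k l : (k <= l)%N -> D l `<=` D k.
  move=> kl v /fin_feasible_lower vD; apply/fin_feasible_lower => i y yZ.
  exact/vD/(lower_bounding_cuts_mono procedure kl).
have cluster_feasible : cluster (u @ \oo) `<=` robust_feasible g Y.
  move=> a ca i _; apply: cuts_cluster_feasible (Y_compact i) (g_convex i)
    (g_cont i) _ ca => k.
  rewrite -(xu k i) => /(lbp_violated procedure)[y [_ ymax Yk]].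
  exists y => // l kl; have /fin_feasible_lower := (uopt l).1; apply.
  by apply: (lower_bounding_cuts_mono procedure kl); rewrite Yk !inE eqxx orbT.
have [] := nested_argmin_cvg (fin_feasible_closed (cP 0%N))
  (fin_feasible_convex (cP 0%N)) F_strict Dmono XD uopt cluster_feasible xs_opt.
rewrite -(argmin_inf xs_opt) -/(optimal_value f g Y) => cvg_u u_le.
have cost k : \sum_(i < m) f i (xt k.+1 i) = total_cost f (u k).
  by apply: eq_bigr => i _; rewrite (lbp_xt procedure) xu.
split=> [|k]; last by rewrite cost.
by rewrite (_ : (fun k => _) = (fun k => total_cost f (u k))) //; apply/funext.
Qed.
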